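(* Let $M=(E,\mathcal I)$ be a matroid with base family $\mathcal B$, let $\widetilde{\mathcal B}$ be a Fulkerson dual family of $\mathcal B$, and let $\eta^*$ be the optimal density for $\mathrm{Mod}_2(\widetilde{\mathcal B})$. Define $\eta_{hom}(e)=r(E)/|E|$ for all $e\in E$. Then $\mathrm{Mod}_2(\widetilde{\mathcal B})\ge\sum_{e\in E}\eta_{hom}(e)^2=r(E)^2/|E|$. Moreover, $M$ is homogeneous if and only if $\eta_{hom}\in\mathrm{Adm}(\widetilde{\mathcal B})$.
   Context: A matroid $M=(E,\mathcal I)$ on a finite set $E$ has rank function $r$ and base family $\mathcal B$. Standing assumption: all matroids are loopless (every singleton independent) with $r(E)>0$. Bases are identified with indicator vectors. For $\Gamma\subseteq\mathbb R^E_{\ge0}$, $\mathrm{Adm}(\Gamma)=\{\rho\in\mathbb R^E_{\ge0}:\sum_e\gamma(e)\rho(e)\ge1\ \forall\gamma\in\Gamma\}$, $\mathrm{Mod}_2(\Gamma)=\min\{\sum_e\rho(e)^2:\rho\in\mathrm{Adm}(\Gamma)\}$ with unique minimizer (optimal density). $\mathrm{BL}(K)=\{\eta\ge0:\eta^T\rho\ge1\ \forall\rho\in K\}$; $\widetilde{\mathcal B}\subseteq\mathbb R^E_{\ge0}$ is a Fulkerson dual family of $\mathcal B$ if $\mathrm{Adm}(\widetilde{\mathcal B})=\mathrm{BL}(\mathrm{Adm}(\mathcal B))$. The matroid $M$ is called homogeneous if $\eta^*$ is constant on $E$. *)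

(* Defs.v *)
From mathcomp Require Import all_boot all_order all_algebra.
From mathcomp Require Import all_classical all_reals all_analysis.
From mathcomp Require Import ring lra.

Set Implicit Arguments.
Unset Strict Implicit.
Unset Printing Implicit Defensive.

Import Order.TTheory GRing.Theory Num.Theory.
Import numFieldNormedType.Exports.

Local Open Scope classical_set_scope.
Local Open Scope ring_scope.

Record matroid (E : finType) := Matroid {
  indep : {set {set E}};
  indep0 : finset.set0 \in indep;
  indepS : forall I J : {set E}, I \subset J -> J \in indep -> I \in indep;
  indep_aug : forall I J : {set E}, I \in indep -> J \in indep ->
    (#|I| < #|J|)%N -> exists2 e, e \in J :\: I & e |: I \in indep
}.

Definition rank (E : finType) (M : matroid E) (A : {set E}) : nat :=
  (\max_(I in indep M | I \subset A) #|I|)%N.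

Definition loopless (E : finType) (M : matroid E) : Prop :=
  forall e : E, [set e]%SET \in indep M.

Definition is_base (E : finType) (M : matroid E) (B : {set E}) : bool :=
  maxset (fun I : {set E} => I \in indep M) B.

Definition base_family (R : realType) (E : finType) (M : matroid E) :
    set (E -> R) :=
  [set b | exists2 B : {set E}, is_base M B & b = fun e => (e \in B)%:R].

Definition nonneg_vec (R : realType) (E : finType) : set (E -> R) :=
  [set x | forall e, 0 <= x e].

Definition dotv (R : realType) (E : finType) (x y : E -> R) : R :=
  \sum_(e : E) x e * y e.

Definition Adm (R : realType) (E : finType) (G : set (E -> R)) : set (E -> R) :=
  [set rho | nonneg_vec rho /\ forall gamma, G gamma -> 1 <= dotv gamma rho].

Definition BL (R : realType) (E : finType) (K : set (E -> R)) : set (E -> R) :=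
  [set eta | nonneg_vec eta /\ forall rho, K rho -> 1 <= dotv eta rho].

Definition energy2 (R : realType) (E : finType) (rho : E -> R) : R :=
  \sum_(e : E) rho e ^+ 2.

Definition is_optimal_density (R : realType) (E : finType)
    (G : set (E -> R)) : set (E -> R) :=
  [set rho | Adm G rho /\ forall rho', Adm G rho' -> energy2 rho <= energy2 rho'].

Definition optimal_density (R : realType) (E : finType) (G : set (E -> R)) :
    E -> R :=
  xget (fun=> 0) (is_optimal_density G).

Definition Mod2 (R : realType) (E : finType) (G : set (E -> R)) : R :=
  inf [set energy2 rho | rho in Adm G].

(* Whenever [Adm G] is nonempty the minimizer exists and is unique, so that the
   default value of [xget] is not used and the infimum [Mod2 G] is a minimum. *)
Section optimal_density_theory.
Variables (R : realType) (E : finType) (G : set (E -> R)).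

Let ev (v : 'rV[R]_#|E|) (e : E) : R := v ord0 (enum_rank e).

Let ev_surj (x : E -> R) : exists v, ev v = x.
Proof.
by exists (\row_i x (enum_val i)); apply/funext => e; rewrite /ev mxE enum_rankK.
Qed.

Let ev_cont e : continuous (ev^~ e).
Proof. exact: coord_continuous. Qed.

Let sum_cont (F : E -> 'rV[R]_#|E| -> R) :
  (forall e, continuous (F e)) -> continuous (fun v => \sum_(e : E) F e v).
Proof.
move=> Fc; apply: continuous_big => [|e _]; last exact: Fc.
exact: (@add_continuous R^o).
Qed.

Let energy_cont : continuous (fun v => energy2 (ev v)).
Proof.
apply: (@sum_cont (fun e v => ev v e * ev v e)) => e v.
by apply: continuousM; exact: ev_cont.
Qed.

Let Adm_closed : closed [set v | Adm G (ev v)].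
Proof.
have -> : [set v | Adm G (ev v)] =
    (\bigcap_(e in [set: E]) (ev^~ e) @^-1` [set t | 0 <= t]) `&`
    (\bigcap_(g in G) (fun v => dotv g (ev v)) @^-1` [set t | 1 <= t]).
  apply/seteqP; split => v /= [v0 v1].
    by split => [e _|g Gg]; [exact: v0|exact: v1].
  by split => [e|g Gg]; [exact: v0|exact: v1].
apply: closedI; apply: closed_bigI => i _; apply: preimage_closed.
- by move=> ? _; exact: ev_cont.
- exact: closed_ge.
- move=> v _; apply: (@sum_cont (fun e v => i e * ev v e)) => e {}v.
  by apply: continuousM; [exact: cst_continuous|exact: ev_cont].
- exact: closed_ge.
Qed.

Lemma optimal_density_ex : Adm G !=set0 -> exists rho, is_optimal_density G rho.
Proof.
move=> [rho0 A0]; have [v0 v0E] := ev_surj rho0; rewrite -v0E in A0.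
pose C := [set v | Adm G (ev v)] `&` (fun v => energy2 (ev v)) @^-1` [set t | t <= energy2 (ev v0)].
have Cc : compact C.
  apply: bounded_closed_compact; last first.
    apply: closedI => //; apply: preimage_closed; last exact: closed_le.
    by move=> v _; exact: energy_cont.
  exists (energy2 (ev v0) + 1); split; first exact: num_real.
  move=> M ltM v [_ /= vle].
  have M0 : 1 <= M.
    apply: le_trans (ltW ltM); rewrite lerDr.
    by apply: sumr_ge0 => e _; exact: sqr_ge0.
  rewrite [leLHS]/Num.norm /= mx_normrE; apply: bigmax_le => [|[i j] _]; first lra.
  rewrite ord1 /=; have : `|v ord0 j| ^+ 2 <= M.
    rewrite real_normK ?num_real//; apply: le_trans (ltW ltM).
    apply: le_trans (_ : energy2 (ev v) <= _); last lra.
    rewrite /energy2 (bigD1 (enum_val j)) //= /ev enum_valK lerDl.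
    by apply: sumr_ge0 => e _; exact: sqr_ge0.
  have := normr_ge0 (v ord0 j); set t := `|_|; nra.
have [|v vC vmin] := compact_EVT_min _ Cc (continuous_subspaceT energy_cont).
  by exists v0; split => //=.
have [Av vle] := set_mem vC.
exists (ev v); split => // rho'; have [w <-] := ev_surj rho' => Aw.
have [le|/ltW le] := leP (energy2 (ev w)) (energy2 (ev v0)).
  by apply: vmin; rewrite inE; split.
exact: le_trans vle le.
Qed.

Lemma optimal_density_uniq x y : is_optimal_density G x -> is_optimal_density G y -> x = y.
Proof.
move=> [[x0 Ax] mx] [[y0 Ay] my]; apply/funext => e.
pose z e := (x e + y e) / 2.
have Az : Adm G z.
  split=> [f|g Gg]; first by rewrite /z; have := x0 f; have := y0 f; lra.
  suff -> : dotv g z = (dotv g x + dotv g y) / 2.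
    by have := Ax g Gg; have := Ay g Gg; lra.
  by rewrite /dotv -big_split /= mulr_suml; apply: eq_bigr => f _; rewrite /z; field.
have par : energy2 z + \sum_f ((x f - y f) / 2) ^+ 2 = (energy2 x + energy2 y) / 2.
  rewrite /energy2 -!big_split /= mulr_suml.
  by apply: eq_bigr => f _; rewrite /z; field.
have : ((x e - y e) / 2) ^+ 2 <= 0.
  apply: (@le_trans _ _ (\sum_f ((x f - y f) / 2) ^+ 2)).
    by rewrite (bigD1 e) //= lerDl; apply: sumr_ge0 => f _; exact: sqr_ge0.
  by have := mx z Az; have := my z Az; lra.
by rewrite le_eqVlt ltNge sqr_ge0 orbF sqrf_eq0; lra.
Qed.

Lemma optimal_densityP :
  Adm G !=set0 -> is_optimal_density G (optimal_density G).
Proof. by move=> /optimal_density_ex; exact: xgetPex. Qed.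

Lemma Mod2_min : Adm G !=set0 -> Mod2 G = energy2 (optimal_density G).
Proof.
move=> /optimal_densityP[Ao om]; apply/eqP; rewrite eq_le; apply/andP; split.
  apply: ge_inf; last by exists (optimal_density G).
  by exists (energy2 (optimal_density G)) => _ [rho Ar <-]; exact: om.
apply: lb_le_inf; first by exists (energy2 (optimal_density G)), (optimal_density G).
by move=> _ [rho Ar <-]; exact: om.
Qed.

End optimal_density_theory.

Definition fulkerson_dual (R : realType) (E : finType) (G Gt : set (E -> R)) :
    Prop :=
  Gt `<=` @nonneg_vec R E /\ Adm Gt = BL (Adm G).

(* A matroid is homogeneous when the optimal density eta_star of a Fulkerson
   dual family of its bases is constant.  The choice of the dual family is
   immaterial: eta_star depends only on [Adm Gt = BL (Adm G)]. *)
Definition homogeneous (R : realType) (E : finType) (eta_star : E -> R) : Prop :=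
  forall e f : E, eta_star e = eta_star f.

Definition eta_hom (R : realType) (E : finType) (M : matroid E) : E -> R :=
  fun=> (rank M [set: E]%SET)%:R / #|E|%:R.
Arguments base_family R {E} M.
Arguments eta_hom R {E} M.

(* Main.v *)
Require Import Defs.
From mathcomp Require Import all_boot all_order all_algebra.
From mathcomp Require Import all_classical all_reals.
From mathcomp Require Import ring lra.

(** Bases all have cardinality [r(E)], so the constant vector [1/r(E)] is
    admissible for the bases and every [eta] in [Adm Bt] has total mass at least
    [r(E)]; Cauchy-Schwarz gives the lower bound on the energy.  Conversely, the
    indicator [b] of a base lies in [Adm Bt], and first-order optimality of
    [eta_star] on this convex set gives [eta_star . eta_star <= eta_star . b];
    for a constant [eta_star = c] this reads [c^2 |E| <= c r(E)], whence
    [c = r(E)/|E|]. *)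

Set Implicit Arguments.
Unset Strict Implicit.
Unset Printing Implicit Defensive.

Import Order.TTheory GRing.Theory Num.Theory.

Local Open Scope ring_scope.

Lemma base_exists (E : finType) (M : matroid E) : exists B, is_base M B.
Proof. by have [B] := maxset_exists (indep0 M); exists B. Qed.

Lemma card_base (E : finType) (M : matroid E) (B : {set E}) :
  is_base M B -> #|B| = rank M [set: E]%SET.
Proof.
move=> /maxsetP[indB maxB]; apply/eqP; rewrite eqn_leq; apply/andP; split.
  by apply: (bigop.leq_bigmax_cond (F := fun I : {set E} => #|I|)); rewrite indB finset.subsetT.
(* An independent set larger than [B] would augment [B] by a new element, against maximality. *)
apply/bigmax_leqP => I /andP[indI _]; rewrite leqNgt; apply/negP => ltBI.
have [e eIB inde] := indep_aug indB indI ltBI.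
move: eIB; rewrite finset.in_setD => /andP[/negP eB _]; apply: eB.
by rewrite -(maxB _ inde (finset.subsetUr _ _)) finset.setU11.
Qed.

Lemma dotv_base (R : realType) (E : finType) (B : {set E}) (c : R) :
  dotv (fun e => (e \in B)%:R) (fun=> c) = #|B|%:R * c.
Proof. by rewrite /dotv -mulr_suml -natr_sum -sum1_card [in RHS]big_mkcond. Qed.

Lemma dotvC (R : realType) (E : finType) (x y : E -> R) : dotv x y = dotv y x.
Proof. by apply: eq_bigr => e _; rewrite mulrC. Qed.

Lemma energy2_cst (R : realType) (E : finType) (c : R) :
  energy2 (fun _ : E => c) = #|E|%:R * c ^+ 2.
Proof. by rewrite /energy2 sumr_const mulr_natl. Qed.

Lemma sub_BL_Adm (R : realType) (E : finType) (G : set (E -> R)) (x : E -> R) :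
  nonneg_vec x -> G x -> BL (Adm G) x.
Proof. by move=> x0 Gx; split=> // rho [_]; apply. Qed.

Lemma Adm_convex (R : realType) (E : finType) (G : set (E -> R))
    (x y : E -> R) (t : R) :
  Adm G x -> Adm G y -> 0 <= t <= 1 -> Adm G (fun e => x e + t * (y e - x e)).
Proof.
move=> [x0 Gx] [y0 Gy] t01; split=> [e|g Gg]; first by have := x0 e; have := y0 e; nra.
suff -> : dotv g (fun e => x e + t * (y e - x e)) =
    dotv g x + t * (dotv g y - dotv g x) by have := Gx g Gg; have := Gy g Gg; nra.
by rewrite /dotv -sumrB mulr_sumr -big_split; apply: eq_bigr => e _ /=; ring.
Qed.

(* First-order optimality: the energy at [x + t (y - x)] is not below the energy
   at [x], and [t = d / (q + d)] is small enough to beat the quadratic term. *)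
Lemma optimal_density_le_dotv (R : realType) (E : finType) (G : set (E -> R))
    (x y : E -> R) :
  is_optimal_density G x -> Adm G y -> energy2 x <= dotv x y.
Proof.
move=> [Ax optx] Ay; rewrite leNgt; apply/negP => ltd.
pose d := energy2 x - dotv x y; pose q := \sum_e (y e - x e) ^+ 2.
have d0 : 0 < d by rewrite subr_gt0.
have q0 : 0 <= q by apply: sumr_ge0 => e _; exact: sqr_ge0.
have qd0 : 0 < q + d by lra.
pose t := d / (q + d).
have t0 : 0 < t by exact: divr_gt0.
have tE : t * (q + d) = d by rewrite /t divfK ?gt_eqF.
have t1 : 0 <= t <= 1 by rewrite (ltW t0) ler_pdivrMr //; lra.
have := optx _ (Adm_convex Ax Ay t1).
have -> : energy2 (fun e => x e + t * (y e - x e)) =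
    energy2 x + (t * 2) * (dotv x y - energy2 x) + t ^+ 2 * q.
  rewrite /energy2 /dotv /q -sumrB !mulr_sumr -!big_split.
  by apply: eq_bigr => e _ /=; ring.
have -> : dotv x y - energy2 x = - d by rewrite opprB.
by nra.
Qed.

Lemma rank_le_mass (R : realType) (E : finType) (M : matroid E) (eta : E -> R) :
  (0 < rank M [set: E]%SET)%N -> BL (Adm (base_family R M)) eta ->
  (rank M [set: E]%SET)%:R <= \sum_e eta e.
Proof.
move=> r_gt0 [_ BLeta]; have r0 : 0 < (rank M [set: E]%SET)%:R :> R by rewrite ltr0n.
have := BLeta (fun=> (rank M [set: E]%SET)%:R^-1).
rewrite /dotv -mulr_suml ler_pdivlMr // mul1r; apply; split=> [e|_ [B baseB ->]].
  by rewrite invr_ge0 ltW.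
by rewrite dotv_base (card_base baseB) divff ?gt_eqF.
Qed.

(** Cauchy-Schwarz against a constant, in square form: expanding the sum of [(eta e - k) ^+ 2]
    bounds the energy below by [2 k] times the mass minus [#|E| k^2], and [k >= 0] lets the mass
    bound enter. *)
Lemma energy2_ge_mass (R : realType) (E : finType) (eta : E -> R) (k : R) :
  0 <= k -> #|E|%:R * k <= \sum_e eta e -> energy2 (fun _ : E => k) <= energy2 eta.
Proof.
move=> k0 mass.
have : 0 <= \sum_e (eta e - k) ^+ 2 by apply: sumr_ge0 => e _; exact: sqr_ge0.
have -> : \sum_e (eta e - k) ^+ 2 =
    energy2 eta - (k * 2) * (\sum_e eta e) + energy2 (fun _ : E => k).
  rewrite /energy2 mulr_sumr -sumrB -big_split.
  by apply: eq_bigr => e _ /=; ring.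
by rewrite energy2_cst; nra.
Qed.

Theorem theorem3p9 (R : realType) (E : finType) (M : matroid E)
    (Hloopless : loopless M) (Hrank : (0 < rank M [set: E]%SET)%N)
    (Bt : set (E -> R)) (HBt : fulkerson_dual (base_family R M) Bt) :
  [/\ \sum_(e : E) eta_hom R M e ^+ 2 <= Mod2 Bt,
      \sum_(e : E) eta_hom R M e ^+ 2 =
        (rank M [set: E]%SET)%:R ^+ 2 / #|E|%:R
    & homogeneous (optimal_density Bt) <-> Adm Bt (eta_hom R M)].
Proof.
have [_ AdmE] := HBt; have [B baseB] := base_exists M.
have r0 : 0 < (rank M [set: E]%SET)%:R :> R by rewrite ltr0n.
have E_gt0 : (0 < #|E|)%N.
  by rewrite -(card_base baseB) in Hrank; exact: leq_trans Hrank (max_card _).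
have n0 : 0 < #|E|%:R :> R by rewrite ltr0n.
have k0 : 0 <= (rank M [set: E]%SET)%:R / #|E|%:R :> R by rewrite divr_ge0 ?ltW.
have AB : Adm Bt (fun e => (e \in B)%:R).
  by rewrite AdmE; apply: sub_BL_Adm => [e|]; [exact: ler0n|exists B].
(* Nonemptiness makes [optimal_density Bt] a true minimizer rather than the default of [xget]. *)
have Bt0 : (Adm Bt !=set0)%classic by exists (fun e => (e \in B)%:R).
have opt := optimal_densityP Bt0.
(* Used twice: for the bound on [Mod2 Bt], and for the optimality of [eta_hom] once it is
   admissible, where uniqueness identifies it with the optimal density. *)
have hom_le eta : Adm Bt eta -> energy2 (eta_hom R M) <= energy2 eta.
  rewrite AdmE => BLeta; apply: energy2_ge_mass => //.
  by rewrite mulrC divfK ?gt_eqF //; exact: rank_le_mass.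
split.
- by rewrite (Mod2_min Bt0); apply: hom_le; case: opt.
- by rewrite [LHS]energy2_cst; field; rewrite gt_eqF.
- split=> [hom|Ahom]; last first.
    by rewrite (optimal_density_uniq opt (conj Ahom hom_le)).
  have /card_gt0P[e0 _] := E_gt0.
  pose c := optimal_density Bt e0.
  have optc : optimal_density Bt = fun=> c by apply/funext => e; exact: hom.
  rewrite optc in opt; have [Ac _] := opt.
  have := optimal_density_le_dotv opt AB.
  rewrite energy2_cst dotvC dotv_base (card_base baseB) => first_order.
  have mass : (rank M [set: E]%SET)%:R <= #|E|%:R * c.
    rewrite AdmE in Ac; have := rank_le_mass Hrank Ac.
    by rewrite sumr_const mulr_natl.
  (* Positivity of [c] allows one factor [c] to be cancelled in [first_order], leaving
     [#|E| c <= r(E)], the reverse of [mass]. *)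
  have c0 : 0 < c by rewrite -(pmulr_rgt0 _ n0); exact: lt_le_trans r0 mass.
  suff cE : c = (rank M [set: E]%SET)%:R / #|E|%:R by rewrite /eta_hom -cE.
  apply: (mulIf (lt0r_neq0 n0)); rewrite divfK ?gt_eqF // mulrC; apply/eqP.
  by rewrite eq_le mass andbT -(ler_pM2r c0) -mulrA -expr2.
Qed.
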